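(* Let $n\ge2$. Let $L_+$ be an oriented link in $S^3$ with a marked positive crossing (in some diagram), and let $L_-$ be the link obtained from $L_+$ by changing the marked positive crossing to a negative crossing. Then $$|s_n(L_+)-s_n(L_-)|\le 2(n-1).$$
   Context: Definition of $s_n(L)$. Put $\omega(x)=x^{n+1}-(n+1)x$ and $\xi=e^{2\pi i/n}$. Let $D$ be a diagram of the oriented link $L$ with $N$ crossings and writhe $w(D)$. (1) Resolutions. The 0-resolution of a crossing is the oriented smoothing; the 1-resolution replaces it by an oriented wide edge, the two incoming strands ending at its tail and the two outgoing strands starting at its head. For $v\in\{0,1\}^N$ let $D_v$ be the resulting resolution; $D_{\mathbf o}$, $\mathbf o=(0,\dots,0)$, is the oriented resolution. (2) Complex of a resolution. Put marks on the strands of $D$, at least one on each arc between consecutive crossings and on each crossingless circle, with variables $x_1,\dots,x_m$, $R=\mathbb C[x_1,\dots,x_m]$, $\deg x_i=2$; $\{k\}$ raises degrees by $k$. Set $\pi_{ij}=\frac{\omega(x_i)-\omega(x_j)}{x_i-x_j}$. Divisions are performed before identifying any variables. $C(D_v)$ is the tensor product over $R$ (Koszul signs, total differential) of the following $\mathbb Z/2$-graded pieces. For an arc going from mark $j$ to the next mark $i$: $R\xrightarrow{\pi_{ij}}R\{1-n\}\xrightarrow{x_i-x_j}R$. For a crossing with nearest marks $x_1,x_2$ (outgoing left, right) and $x_4,x_3$ (incoming left, right): if 0-resolved, $R\oplus R\{2-2n\}\xrightarrow{P_0}R\{1-n\}^{\oplus2}\xrightarrow{P_1}R\oplus R\{2-2n\}$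 with $P_0=\begin{pmatrix}\pi_{14}&x_2-x_3\\ \pi_{23}&x_4-x_1\end{pmatrix}$, $P_1=\begin{pmatrix}x_1-x_4&x_2-x_3\\ \pi_{23}&-\pi_{14}\end{pmatrix}$; if 1-resolved, $R\{-1\}\oplus R\{3-2n\}\xrightarrow{Q_0}R\{-n\}\oplus R\{2-n\}\xrightarrow{Q_1}R\{-1\}\oplus R\{3-2n\}$ with $Q_0=\begin{pmatrix}u_1&x_1x_2-x_3x_4\\ u_2&x_3+x_4-x_1-x_2\end{pmatrix}$, $Q_1=\begin{pmatrix}x_1+x_2-x_3-x_4&x_1x_2-x_3x_4\\ u_2&-u_1\end{pmatrix}$, where $G$ is the polynomial with $G(x+y,xy)=\omega(x)+\omega(y)$, $u_1=\frac{G(x_1+x_2,x_1x_2)-G(x_3+x_4,x_1x_2)}{x_1+x_2-x_3-x_4}$, $u_2=\frac{G(x_3+x_4,x_1x_2)-G(x_3+x_4,x_3x_4)}{x_1x_2-x_3x_4}$. The total differential squares to $0$; $H(D_v)$ is its homology, with increasing filtration $\mathcal F^jH(D_v)$ = classes having a cycle representative all of whose terms have degree $\le j$. Changing one crossing's resolution, there are chain maps $\chi_0$ (from 0- to 1-resolution) given by $U_0=\begin{pmatrix}x_4-x_2&0\\ a&1\end{pmatrix}$ in $\mathbb Z/2$-degree 0 and $U_1=\begin{pmatrix}x_4&-x_2\\ -1&1\end{pmatrix}$ in degree 1, $a=-u_2+\frac{u_1+x_1u_2-\pi_{23}}{x_1-x_4}$, and $\chi_1$ (from 1- to 0-resolution)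 given by the adjugate matrices of $U_0,U_1$. (3) Cube. Let $s(v)$ be the number of positive crossings with $v_i=1$ plus the number of negative crossings with $v_i=0$. Then $CKh'^k(D)=\bigoplus_{s(v)=k+\frac12(N-w(D))}H(D_v)\{(1-n)w(D)-k\}$, with differential the sum of the maps induced by $\chi_0$ at positive crossings and $\chi_1$ at negative crossings (with the standard signs making squares anticommute). It preserves the filtration; $HKh'(D)$ is its homology, filtered by $\mathcal F^jHKh'(D)$ = classes having a cycle representative in $\mathcal F^jCKh'(D)$. As a filtered homologically graded space it is an invariant of $L$. For $0\neq x$ in a filtered space, $\mathrm{qgr}(x)$ is the smallest $j$ with $x\in\mathcal F^j$. (4) If $D_{\mathbf o}$ has $r$ circles, then the summand $H(D_{\mathbf o})\{(1-n)w(D)\}$ (homological degree 0) is $\mathbb C[x_1,\dots,x_r]/(x_1^n-1,\dots,x_r^n-1)\{(1-n)(w(D)+r)\}$, $x_e$ being multiplication by the variable of any mark on the $e$-th circle. For $0\le i\le n-1$ set $g^D_i=\prod_{e=1}^r\frac{x_e^n-1}{x_e-\xi^i}$; it is a cycle. Define $s_n(L)=\mathrm{qgr}([g^D_i])-n+1\in\mathbb Z$; this does not depend on $D$ or $i$. *)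

(* Defs.v *)
From HB Require Import structures.
From mathcomp Require Import all_boot all_order all_algebra.
From mathcomp Require Import ring.
From mathcomp Require Import complex mpoly.
From mathcomp Require Import boolp classical_sets reals.
From mathcomp Require trigo.

Set Implicit Arguments.
Unset Strict Implicit.
Unset Printing Implicit Defensive.

Import Order.TTheory GRing.Theory Num.Theory.
Local Open Scope ring_scope.

(** * Oriented link diagrams *)

(* The strands of a diagram are cut at its marks into pieces: arcs, running
   from a mark to the next one, and crossings.  A crossing is drawn with both
   strands going upwards; [inc c b] and [out c b] are the marks nearest to [c]
   on its incoming and outgoing strands, on the left for b = false and on the
   right for b = true.  In the usual numbering of the four ends of a crossing,
   x1 = out left, x2 = out right, x3 = inc right, x4 = inc left. *)
Record shadow := Shadow {
  ncr : nat;
  narc : nat;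
  nmark : nat;
  tail : 'I_narc -> 'I_nmark;
  head : 'I_narc -> 'I_nmark;
  inc : 'I_ncr -> bool -> 'I_nmark;
  out : 'I_ncr -> bool -> 'I_nmark
}.

Definition symc (T : finType) (e : rel T) : rel T := [rel x y | e x y || e y x].

Definition nclasses (T : finType) (e : rel T) : nat := n_comp (symc e) predT.

Section Shadow.
Variable S : shadow.

Definition piece_end (p : 'I_(narc S) + 'I_(ncr S) * bool) : 'I_(nmark S) :=
  match p with inl a => head a | inr (c, b) => out c b end.

Definition piece_start (p : 'I_(narc S) + 'I_(ncr S) * bool) : 'I_(nmark S) :=
  match p with inl a => tail a | inr (c, b) => inc c b end.

Definition adjacent : rel 'I_(nmark S) := fun x y =>
  [exists a, (x == tail a) && (y == head a)] ||
  [exists c, exists b, exists b',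
     ((x == inc c b) || (x == out c b)) && ((y == inc c b') || (y == out c b'))].

(* A dart is a mark with a direction of travel (true = along the orientation).
   The relation goes from a dart to the next one on the boundary of the face to
   its left. *)
Definition face_step : rel ('I_(nmark S) * bool) := fun d d' =>
  [exists a, (d == (tail a, true)) && (d' == (head a, true))
          || (d == (head a, false)) && (d' == (tail a, false))] ||
  [exists c, [|| (d == (inc c false, true)) && (d' == (out c false, true)),
                 (d == (inc c true, true)) && (d' == (inc c false, false)),
                 (d == (out c false, false)) && (d' == (out c true, true)) |
                 (d == (out c true, false)) && (d' == (inc c true, false))]].

(* Euler's formula summed over the connected components: as the vertices are
   the crossings and the arcs, and the edges are the marks,
   V - E = (ncr + narc) - (narc + 2 * ncr) = - ncr. *)
Definition planar : Prop :=
  nclasses face_step = (ncr S + 2 * nclasses adjacent)%N.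

(* Every mark is entered from exactly one piece and left into exactly one
   piece; in particular every strand between two crossings and every
   crossingless circle carries at least one mark. *)
Definition well_formed : Prop :=
  [/\ bijective piece_end, bijective piece_start & planar].

(* Consecutive marks on a circle of the oriented resolution. *)
Definition smooth_step : rel 'I_(nmark S) := fun x y =>
  [exists a, (x == tail a) && (y == head a)] ||
  [exists c, exists b, (x == inc c b) && (y == out c b)].

Definition same_circle : rel 'I_(nmark S) := connect (symc smooth_step).

Definition circle_rep : pred 'I_(nmark S) := roots (symc smooth_step).

Definition ncircles : nat := nclasses smooth_step.

End Shadow.

(* The sign of a crossing determines which of its two strands is the upper
   one. *)
Record diagram := Diagram {
  shadow_of :> shadow;
  positive : 'I_(ncr shadow_of) -> bool;
  diagram_wf : well_formed shadow_of
}.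

Definition writhe (D : diagram) : int :=
  \sum_(c < ncr D) (if positive c then 1 else -1).

Definition crossing_change (D : diagram) (c : 'I_(ncr D)) : diagram :=
  @Diagram (shadow_of D)
    (fun c' => if c' == c then ~~ positive c' else positive c') (diagram_wf D).

(** * The polynomials entering the matrix factorizations *)

(* The polynomial (p(X) - p(Y)) / (X - Y), evaluated at X = x and Y = y.  It
   makes sense for x = y too, and commutes with ring morphisms
   ([ddiff_rmorph]): divisions are performed before identifying variables. *)
Definition ddiff (A : comNzRingType) (p : {poly A}) (x y : A) : A :=
  \sum_(k < size p) p`_k * \sum_(l < k) x ^+ (k.-1 - l) * y ^+ l.

Lemma ddiffP (A : comNzRingType) (p : {poly A}) (x y : A) :
  (x - y) * ddiff p x y = p.[x] - p.[y].
Proof.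
rewrite !horner_coef -sumrB mulr_sumr; apply: eq_bigr => k _.
by rewrite mulrCA -subrXX mulrBr.
Qed.

Lemma ddiff_rmorph (A B : comNzRingType) (f : {rmorphism A -> B})
    (p : {poly A}) (x y : A) :
  f (ddiff p x y) = ddiff (map_poly f p) (f x) (f y).
Proof.
rewrite /ddiff rmorph_sum /=.
have sz : (size (map_poly f p) <= size p)%N.
  by apply/leq_sizeP => k /leq_sizeP pk; rewrite coef_map /= pk ?rmorph0.
rewrite [RHS](big_ord_widen _ (fun k => (map_poly f p)`_k *
   \sum_(l < k) f x ^+ (k.-1 - l) * f y ^+ l) sz).
rewrite [RHS]big_mkcond; apply: eq_bigr => k _.
rewrite rmorphM rmorph_sum /= -coef_map; case: ltnP => [_|ks].
  by congr (_ * _); apply: eq_bigr => l _; rewrite rmorphM !rmorphXn.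
by rewrite nth_default ?mul0r.
Qed.

Section Potential.
Variables (n : nat) (A : comNzRingType).

Definition omega : {poly A} := 'X ^+ n.+1 - 'X *+ n.+1.

Definition ppi (x y : A) : A := ddiff omega x y.

(* psum k expresses x^k + y^k in the inner variable s = x + y and the outer
   variable t = x * y. *)
Fixpoint psum (k : nat) : {poly {poly A}} :=
  match k with
  | 0 => 2%:R
  | k1.+1 =>
      match k1 with
      | 0 => ('X)%:P
      | k2.+1 => ('X)%:P * psum k1 - 'X * psum k2
      end
  end.

Definition GG : {poly {poly A}} := psum n.+1 - ('X)%:P *+ n.+1.

Lemma GGP (x y : A) : GG.[(x * y)%:P].[x + y] = omega.[x] + omega.[y].
Proof.
have E k : (psum k).[(x * y)%:P].[x + y] = x ^+ k + y ^+ k /\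
           (psum k.+1).[(x * y)%:P].[x + y] = x ^+ k.+1 + y ^+ k.+1.
  elim: k => [|k [IH1 IH2]].
    by split; rewrite /= ?expr1 -?[2]polyC_natr ?hornerC ?hornerX // -polyC_natr hornerC.
  split=> //; set P := psum k.+2.
  have -> : P = ('X)%:P * psum k.+1 - 'X * psum k by [].
  rewrite !hornerE /= IH1 IH2 !exprS.
  by ring.
have [_ H] := E n; rewrite /GG /omega !hornerE H /=.
by rewrite !(hornerMn, hornerX, hornerC) mulrnDl opprD addrACA !addrA.
Qed.

Definition u1 (x1 x2 x3 x4 : A) : A :=
  ddiff GG.[(x1 * x2)%:P] (x1 + x2) (x3 + x4).

Definition u2 (x1 x2 x3 x4 : A) : A :=
  ddiff (map_poly (horner_eval (x3 + x4)) GG) (x1 * x2) (x3 * x4).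

End Potential.

(* The polynomial u1 + x1 * u2 - pi_23 vanishes for x1 = x4, so its quotient by
   x1 - x4 is its divided difference in the variable x1. *)
Definition aa (n : nat) (A : comNzRingType) (x1 x2 x3 x4 : A) : A :=
  - u2 n x1 x2 x3 x4 +
  ddiff (u1 n 'X x2%:P x3%:P x4%:P + 'X * u2 n 'X x2%:P x3%:P x4%:P
         - ppi n x2%:P x3%:P) x1 x4.

Lemma psum_rmorph (A B : comNzRingType) (f : {rmorphism A -> B}) (k : nat) :
  map_poly (map_poly f) (psum A k) = psum B k.
Proof.
have E : map_poly (map_poly f) (psum A k) = psum B k /\
         map_poly (map_poly f) (psum A k.+1) = psum B k.+1.
  elim: k => [|k [IH1 IH2]]; first by split; rewrite /= ?rmorph_nat // map_polyC /= map_polyX.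
  split=> //; rewrite /= in IH2 *.
  by rewrite rmorphB !rmorphM /= map_polyC /= !map_polyX IH1 IH2.
by case: E.
Qed.

Lemma GG_rmorph (n : nat) (A B : comNzRingType) (f : {rmorphism A -> B}) :
  map_poly (map_poly f) (GG n A) = GG n B.
Proof.
by rewrite /GG rmorphB rmorphMn [X in X - _ = _](psum_rmorph f) /= map_polyC /= map_polyX.
Qed.

Lemma ppi_rmorph (n : nat) (A B : comNzRingType) (f : {rmorphism A -> B})
    (x y : A) : f (ppi n x y) = ppi n (f x) (f y).
Proof.
by rewrite /ppi ddiff_rmorph /omega rmorphB rmorphXn rmorphMn /= map_polyX.
Qed.

Lemma u1_rmorph (n : nat) (A B : comNzRingType) (f : {rmorphism A -> B})
    (x1 x2 x3 x4 : A) :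
  f (u1 n x1 x2 x3 x4) = u1 n (f x1) (f x2) (f x3) (f x4).
Proof.
rewrite /u1 ddiff_rmorph !rmorphD; congr ddiff.
by rewrite -horner_map /= GG_rmorph map_polyC /= rmorphM.
Qed.

Lemma u2_rmorph (n : nat) (A B : comNzRingType) (f : {rmorphism A -> B})
    (x1 x2 x3 x4 : A) :
  f (u2 n x1 x2 x3 x4) = u2 n (f x1) (f x2) (f x3) (f x4).
Proof.
rewrite /u2 ddiff_rmorph !rmorphM; congr ddiff.
rewrite -(GG_rmorph n f) -!map_poly_comp; apply: eq_map_poly => p /=.
by rewrite /horner_eval -rmorphD horner_map.
Qed.

Lemma aaP (n : nat) (A : idomainType) (x1 x2 x3 x4 : A) : x2 != x3 ->
  (x1 - x4) * (aa n x1 x2 x3 x4 + u2 n x1 x2 x3 x4) =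
  u1 n x1 x2 x3 x4 + x1 * u2 n x1 x2 x3 x4 - ppi n x2 x3.
Proof.
move=> x23; pose F := u1 n 'X x2%:P x3%:P x4%:P
  + 'X * u2 n 'X x2%:P x3%:P x4%:P - ppi n x2%:P x3%:P.
have FE y : F.[y] = u1 n y x2 x3 x4 + y * u2 n y x2 x3 x4 - ppi n x2 x3.
  rewrite -[LHS]/(horner_eval y F) /F rmorphB rmorphD rmorphM.
  by rewrite u1_rmorph u2_rmorph ppi_rmorph /= /horner_eval !hornerE.
rewrite /aa -/F addrAC addNr add0r ddiffP !FE.
suff -> : u1 n x4 x2 x3 x4 + x4 * u2 n x4 x2 x3 x4 - ppi n x2 x3 = 0.
  by rewrite subr0.
have /mulfI : x2 - x3 != 0 by rewrite subr_eq0.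
apply; rewrite mulr0 mulrBr mulrDr /ppi ddiffP.
have -> : x2 - x3 = x4 + x2 - (x3 + x4) by ring.
rewrite ddiffP mulrA; have -> : (x4 + x2 - (x3 + x4)) * x4 = x4 * x2 - x3 * x4 by ring.
rewrite ddiffP; have E p (a b : A) : (map_poly (horner_eval a) p).[b] = p.[b, a].
  by rewrite -[b in LHS](hornerC b a) -/(horner_eval a _) horner_map.
by rewrite !E [x3 + x4]addrC [x3 * x4]mulrC !GGP; ring.
Qed.

Definition mx2 (A : Type) (a b c d : A) : 'M[A]_2 :=
  \matrix_(i, j) if i == ord0 then (if j == ord0 then a else b)
                 else (if j == ord0 then c else d).

(** * The complex of a resolution *)

Section Complex.
Variables (R : realType) (n : nat) (S : shadow).

Local Notation mark := 'I_(nmark S).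
Local Notation poly_ring := {mpoly R[i][nmark S]}.
Local Notation x_ m := ('X_m : poly_ring).

(* A vertex of the cube; true stands for the 1-resolution. *)
Definition vertex := {ffun 'I_(ncr S) -> bool}.

(* Basis of the tensor product of the pieces.  A basis element of an arc is its
   Z/2-degree; one of a crossing is its Z/2-degree with its position in the
   rank 2 summand of that degree.  The factors are ordered with the arcs first,
   followed by the crossings. *)
Definition state :=
  ({ffun 'I_(narc S) -> bool} * {ffun 'I_(ncr S) -> bool * 'I_2})%type.

Definition chain := {ffun state -> poly_ring}.

Definition arc_shift (p : bool) : int := if p then 1 - n%:Z else 0.

Definition cr_shift (wide p : bool) (k : 'I_2) : int :=
  match wide, p with
  | false, false => if k == ord0 then 0 else 2 - 2 * n%:Z
  | false, true => 1 - n%:Z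
  | true, false => if k == ord0 then -1 else 3 - 2 * n%:Z
  | true, true => if k == ord0 then - n%:Z else 2 - n%:Z
  end.

Definition state_shift (v : vertex) (t : state) : int :=
  \sum_a arc_shift (t.1 a) + \sum_c cr_shift (v c) (t.2 c).1 (t.2 c).2.

(* The differential of a piece out of its part of Z/2-degree p. *)
Definition arc_map (a : 'I_(narc S)) (p : bool) : poly_ring :=
  let xi := x_ (head a) in let xj := x_ (tail a) in
  if p then xi - xj else ppi n xi xj.

Definition cr_map (c : 'I_(ncr S)) (wide p : bool) : 'M[poly_ring]_2 :=
  let x1 := x_ (out c false) in let x2 := x_ (out c true) in
  let x3 := x_ (inc c true) in let x4 := x_ (inc c false) in
  let v1 := u1 n x1 x2 x3 x4 in let v2 := u2 n x1 x2 x3 x4 in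
  match wide, p with
  | false, false => mx2 (ppi n x1 x4) (x2 - x3)
                        (ppi n x2 x3) (x4 - x1)
  | false, true => mx2 (x1 - x4) (x2 - x3)
                       (ppi n x2 x3) (- ppi n x1 x4)
  | true, false => mx2 v1 (x1 * x2 - x3 * x4)
                       v2 (x3 + x4 - x1 - x2)
  | true, true => mx2 (x1 + x2 - x3 - x4) (x1 * x2 - x3 * x4)
                      v2 (- v1)
  end.

Definition U_map (c : 'I_(ncr S)) (p : bool) : 'M[poly_ring]_2 :=
  let x1 := x_ (out c false) in let x2 := x_ (out c true) in
  let x3 := x_ (inc c true) in let x4 := x_ (inc c false) in
  if p then mx2 x4 (- x2) (-1) 1
  else mx2 (x4 - x2) 0 (aa n x1 x2 x3 x4) 1.

Definition set_arc (t : state) (a : 'I_(narc S)) (p : bool) : state :=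
  ([ffun a' => if a' == a then p else t.1 a'], t.2).

Definition set_cr (t : state) (c : 'I_(ncr S)) (q : bool * 'I_2) : state :=
  (t.1, [ffun c' => if c' == c then q else t.2 c']).

Definition arc_sign (t : state) (a : 'I_(narc S)) : poly_ring :=
  (-1) ^+ (\sum_(a' < narc S | (a' < a)%N) t.1 a')%N.

Definition cr_sign (t : state) (c : 'I_(ncr S)) : poly_ring :=
  (-1) ^+ (\sum_a t.1 a + \sum_(c' < ncr S | (c' < c)%N) (t.2 c').1)%N.

Definition diff (v : vertex) (f : chain) : chain := [ffun t : state =>
  \sum_a arc_sign t a * arc_map a (~~ t.1 a) * f (set_arc t a (~~ t.1 a)) +
  \sum_c cr_sign t c *
    \sum_(k < 2) cr_map c (v c) (~~ (t.2 c).1) (t.2 c).2 k *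
                 f (set_cr t c (~~ (t.2 c).1, k))].

Definition chi0 (c : 'I_(ncr S)) (f : chain) : chain := [ffun t : state =>
  \sum_(k < 2) U_map c (t.2 c).1 (t.2 c).2 k * f (set_cr t c ((t.2 c).1, k))].

Definition chi1 (c : 'I_(ncr S)) (f : chain) : chain := [ffun t : state =>
  \sum_(k < 2) (\adj (U_map c (t.2 c).1)) (t.2 c).2 k *
               f (set_cr t c ((t.2 c).1, k))].

Definition pscale (p : poly_ring) (f : chain) : chain := [ffun t => p * f t].

(* All the terms of f have degree at most j; [msize] is the total degree plus
   one, and the variables have degree 2. *)
Definition deg_le (v : vertex) (j : int) (f : chain) : Prop :=
  forall t, f t != 0 -> (2 * (msize (f t)).-1)%:Z + state_shift v t <= j.

(* The homology H(D_v) is represented by the cycles modulo [homologous]. *)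
Definition cycle_at (v : vertex) (x : chain) : Prop := diff v x = 0.

Definition homologous (v : vertex) (x y : chain) : Prop :=
  exists z, x - y = diff v z.

Definition Hfilt (v : vertex) (j : int) (x : chain) : Prop :=
  exists y, [/\ cycle_at v y, homologous v x y & deg_le v j y].

(** * The homology of the oriented resolution *)

Definition vertex0 : vertex := [ffun=> false].

(* The ideal with quotient C[x_1, ..., x_r] / (x_1^n - 1, ..., x_r^n - 1), a
   mark being sent to the variable of its circle. *)
Definition circle_ideal (p : poly_ring) : Prop :=
  exists (b : mark -> mark -> poly_ring) (d : mark -> poly_ring),
    p = \sum_i \sum_(j | same_circle i j) b i j * (x_ i - x_ j)
        + \sum_i d i * (x_ i ^+ n - 1).

(* The class of x corresponds to 1 under a filtered isomorphism of modules
   between H(D_o) and C[x_1, ..., x_r] / (x_e^n - 1) {(1 - n) r}.  Such an x is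
   unique up to homology and a nonzero scalar, since the units of filtration
   degree 0 of the latter ring are the scalars (n >= 2). *)
Definition is_unit_cycle (x : chain) : Prop :=
  [/\ cycle_at vertex0 x,
      forall y, cycle_at vertex0 y ->
        exists p, homologous vertex0 y (pscale p x),
      forall p, homologous vertex0 (pscale p x) 0 <-> circle_ideal p &
      forall p j, Hfilt vertex0 j (pscale p x) <->
        exists q, circle_ideal (p - q) /\
          (q != 0 -> (2 * (msize q).-1)%:Z + (1 - n%:Z) * (ncircles S)%:Z <= j)].

Definition unit_cycle : chain := xget 0 [set x | is_unit_cycle x]%classic.

Definition xi : R[i] :=
  Complex (trigo.cos (2 * trigo.pi / n%:R)) (trigo.sin (2 * trigo.pi / n%:R)).

Definition gpoly (i : nat) : {poly R[i]} := ('X ^+ n - 1) %/ ('X - (xi ^+ i)%:P).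

Definition g_cycle (i : nat) : chain :=
  pscale (\prod_(e | circle_rep e) (map_poly (@mpolyC _ _) (gpoly i)).[x_ e])
         unit_cycle.

End Complex.

(** * The cube of resolutions *)

Section Cube.
Variables (R : realType) (n : nat) (D : diagram).

Local Notation chain := (chain R D).
Local Notation vertex := (vertex D).

(* Elements of the sum of all the H(D_v), represented by families of cycles. *)
Definition family := {ffun vertex -> chain}.

Definition height_bit (v : vertex) (c : 'I_(ncr D)) : bool :=
  v c == positive c.

Definition flip (v : vertex) (c : 'I_(ncr D)) : vertex :=
  [ffun c' => if c' == c then ~~ v c' else v c'].

Definition hdeg (v : vertex) : int :=
  (\sum_c height_bit v c)%N%:Z - (((ncr D)%:Z - writhe D) %/ 2)%Z.

Definition qshift (v : vertex) : int := (1 - n%:Z) * writhe D - hdeg v.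

Definition cube_sign (v : vertex) (c : 'I_(ncr D)) : int :=
  (-1) ^+ (\sum_(c' < ncr D | (c' < c)%N) height_bit v c')%N.

Definition cube_diff (X : family) : family := [ffun v : vertex =>
  \sum_(c | height_bit v c)
    (if positive c then chi0 n c (X (flip v c)) else chi1 n c (X (flip v c)))
      *~ cube_sign v c].

Definition is_family (X : family) : Prop :=
  forall v, cycle_at n v (X v).

Definition fam_eq (X Y : family) : Prop :=
  forall v, homologous n v (X v) (Y v).

Definition CKh_filt (j : int) (X : family) : Prop :=
  forall v, Hfilt n v (j - qshift v) (X v).

(* The homology of the cube, represented by the cycles modulo [cube_homologous],
   and its filtration. *)
Definition cube_cycle (X : family) : Prop :=
  is_family X /\ fam_eq (cube_diff X) 0.

Definition cube_homologous (X Y : family) : Prop :=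
  exists Z, is_family Z /\ fam_eq (X - Y) (cube_diff Z).

Definition HKh_filt (j : int) (X : family) : Prop :=
  exists Y, [/\ cube_cycle Y, cube_homologous X Y & CKh_filt j Y].

(* Meaningful when the class of X is nonzero; 0 if there is no least j. *)
Definition qgr (X : family) : int :=
  xget 0 [set j | HKh_filt j X /\ forall j', HKh_filt j' X -> j <= j']%classic.

Definition g_family (i : nat) : family :=
  [ffun v => if v == vertex0 D then g_cycle R n D i else 0].

Definition s_n (i : nat) : int := qgr (g_family i) - n%:Z + 1.

End Cube.

(* Main.v *)
Require Import Defs.
From mathcomp Require Import all_boot all_order all_algebra.
From mathcomp Require Import ring zify.
From mathcomp Require Import complex mpoly.
From mathcomp Require Import boolp classical_sets reals.
From mathcomp Require trigo.

(** Let D and D' differ by the sign of the crossing c, positive in D.  The two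
    cubes have the same vertices and the same complexes C(D_v).  At a vertex
    with v c = 0 the homological degrees agree and the quantum shifts differ by
    2 (n - 1), and the class g_i lives at such a vertex.  The edges at c go from
    the 0-resolution to the 1-resolution in D (chi0), the other way round in D'
    (chi1).  So the part with v c = 0 is a quotient of the cube of D and a
    subcomplex of the cube of D'.

    Hence keeping the components with v c = 0 and killing the others is a chain
    map from the cube of D to that of D'; it raises the filtration by 2 (n - 1)
    and sends g_i to g_i, up to a sign.

    In the other direction the components with v c = 0 are kept, but multiplied
    by h, the sum of the x3^(n-1-l) x4^l for l < n, of degree 2 (n - 1), with
    x3 and x4 the incoming marks of c.  This map is filtered of degree 0.  It
    commutes with the differentials because h kills the homology of D_v when
    c is 1-resolved: the matrix factorization of the wide edge factors the
    polynomial G(x1 + x2, x1 x2) - G(x3 + x4, x3 x4), differentiating it in the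
    variable x3 x4 gives a homotopy between 0 and, up to sign, the partial
    derivative of G in its second variable at (x3 + x4, x3 x4), and this partial
    derivative is - (n + 1) h ([u2_complete_hom], [complete_hom_boundary]).  On g_i all
    marks act as xi^i, so h acts as n xi^(i (n - 1)), a nonzero scalar
    ([acts_complete_hom]).

    Therefore the set of the j with [g_i] in F^j for D' is contained in the same
    set for D, and the latter translated by 2 (n - 1) is contained in the
    former.  This bounds the difference of the least elements, and it shows that
    one set has a least element if and only if the other has one
    ([least_close]). *)

Set Implicit Arguments.
Unset Strict Implicit.
Unset Printing Implicit Defensive.

Import Order.TTheory GRing.Theory Num.Theory.
Local Open Scope ring_scope.

(** * The matrices at a crossing *)

Lemma aa_rmorph (n : nat) (A B : comNzRingType) (f : {rmorphism A -> B})
    (x1 x2 x3 x4 : A) :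
  f (aa n x1 x2 x3 x4) = aa n (f x1) (f x2) (f x3) (f x4).
Proof.
rewrite /aa rmorphD rmorphN u2_rmorph ddiff_rmorph; congr (_ + ddiff _ _ _).
rewrite !rmorphB rmorphD rmorphM /=.
by rewrite u1_rmorph u2_rmorph ppi_rmorph /= !map_polyX !map_polyC.
Qed.

(** Both sides are the difference of the potentials of the outgoing and of the
    incoming marks. *)
Lemma u1u2P (n : nat) (A : comNzRingType) (x1 x2 x3 x4 : A) :
  (x1 + x2 - x3 - x4) * u1 n x1 x2 x3 x4 + (x1 * x2 - x3 * x4) * u2 n x1 x2 x3 x4
  = (x1 - x4) * ppi n x1 x4 + (x2 - x3) * ppi n x2 x3.
Proof.
have E p (a b : A) : (map_poly (horner_eval a) p).[b] = p.[b, a].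
  by rewrite -[b in LHS](hornerC b a) -/(horner_eval a _) horner_map.
rewrite /ppi !ddiffP; have -> : x1 + x2 - x3 - x4 = x1 + x2 - (x3 + x4) by ring.
by rewrite !ddiffP !E !GGP; ring.
Qed.

(** These two equations express the divided differences of omega through u1, u2
    and the coefficient a of U_0.  They are linear in a, and substituting them
    turns every relation between the matrices at a crossing into a polynomial
    identity. *)
Definition ppi_split (n : nat) (A : comNzRingType) (x1 x2 x3 x4 : A) : Prop :=
  let v1 := u1 n x1 x2 x3 x4 in let v2 := u2 n x1 x2 x3 x4 in
  let a := aa n x1 x2 x3 x4 in
  ppi n x1 x4 = v1 + x2 * v2 + a * (x2 - x3) /\
  ppi n x2 x3 = v1 + x4 * v2 - a * (x1 - x4).

Lemma ppi_split_idomain (n : nat) (A : idomainType) (x1 x2 x3 x4 : A) :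
  x1 != x4 -> x2 != x3 -> ppi_split n x1 x2 x3 x4.
Proof.
move=> x14 x23; have aE := aaP n x1 x4 x23; have uE := u1u2P n x1 x2 x3 x4.
have /mulfI inj : x1 - x4 != 0 by rewrite subr_eq0.
rewrite /ppi_split /=.
move: (aa _ _ _ _ _) (u1 _ _ _ _ _) (u2 _ _ _ _ _) (ppi _ _ _) (ppi _ _ _) aE uE.
move=> a v1 v2 p14 p23 aE uE.
have p23E : p23 = v1 + x4 * v2 - a * (x1 - x4).
  have -> : p23 = v1 + x1 * v2 - (v1 + x1 * v2 - p23) by ring.
  by rewrite -aE; ring.
split=> //; apply: inj.
have -> : (x1 - x4) * p14 =
  (x1 + x2 - x3 - x4) * v1 + (x1 * x2 - x3 * x4) * v2 - (x2 - x3) * p23.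
  by rewrite uE; ring.
by rewrite p23E; ring.
Qed.

Lemma ppi_split_rmorph (n : nat) (A B : comNzRingType) (f : {rmorphism A -> B})
    (x1 x2 x3 x4 : A) :
  ppi_split n x1 x2 x3 x4 -> ppi_split n (f x1) (f x2) (f x3) (f x4).
Proof.
rewrite /ppi_split /= -!ppi_rmorph -u1_rmorph -u2_rmorph -aa_rmorph.
by move=> [-> ->]; split; rewrite -!(rmorphM, rmorphB, rmorphD).
Qed.

(** Both equations are obtained after multiplication by x1 - x4, which is not
    cancellable when marks coincide; so they are proved for four independent
    variables over the integers and then specialized. *)
Lemma ppi_splitP (n : nat) (A : comNzRingType) (x1 x2 x3 x4 : A) :
  ppi_split n x1 x2 x3 x4.
Proof.
pose h (i : 'I_4) := nth 0 [:: x1; x2; x3; x4] i.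
pose f : {rmorphism {mpoly int[4]} -> A} := mmap (intmul 1) h.
pose X i : {mpoly int[4]} := 'X_(inord i).
have XE i : (i < 4)%N -> f (X i) = nth 0 [:: x1; x2; x3; x4] i.
  by move=> i4; rewrite /f /= mmapX mmap1U /h inordK.
have Xneq i j : (i < 4)%N -> (j < 4)%N -> i != j -> X i != X j.
  move=> i4 j4; apply: contraNneq => Xij.
  have := congr1 (fun p : {mpoly int[4]} => p@_U_(inord i)) Xij.
  rewrite !mcoeffXU eqxx; have [ij _|//] := eqVneq (inord j : 'I_4) (inord i).
  by rewrite -(inordK i4) -(inordK j4) ij.
have := ppi_split_rmorph f (@ppi_split_idomain n _ (X 0%N) (X 1%N) (X 2%N) (X 3%N) _ _).
by rewrite !XE //; apply; apply: Xneq.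
Qed.

(** * The derivative of the potential of a wide edge *)

Definition complete_hom (A : comNzRingType) (k : nat) (x y : A) : A :=
  \sum_(l < k) x ^+ (k.-1 - l) * y ^+ l.

Lemma complete_homSr (A : comNzRingType) k (x y : A) :
  complete_hom k.+1 x y = x * complete_hom k x y + y ^+ k.
Proof.
rewrite /complete_hom big_ord_recr /= subnn expr0 mul1r mulr_sumr; congr (_ + _).
apply: eq_bigr => l _; rewrite mulrA -exprS; congr (x ^+ _ * _).
by case: k l => [[]|k] l //=; rewrite -subSn // -ltnS.
Qed.

Lemma complete_homSl (A : comNzRingType) k (x y : A) :
  complete_hom k.+1 x y = x ^+ k + y * complete_hom k x y.
Proof.
rewrite /complete_hom big_ord_recl /= subn0 expr0 mulr1 mulr_sumr; congr (_ + _).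
apply: eq_bigr => l _; rewrite mulrCA -exprS /bump /= add1n; congr (x ^+ _ * _).
by rewrite subnS -subn1 subnAC subn1.
Qed.

Lemma ddiff_deriv (A : comNzRingType) (p : {poly A}) (x y : A) :
  exists e, ddiff p x y = p^`().[y] + (x - y) * e.
Proof.
have /boolp.choice [e eE] : forall k, exists e,
    complete_hom k x y = y ^+ k.-1 *+ k + (x - y) * e.
  elim=> [|k [e eE]].
    by exists 0; rewrite /complete_hom big_ord0 mulr0n mulr0 addr0.
  exists (y ^+ k.-1 *+ k + x * e); rewrite complete_homSr eE.
  case: k {eE} => [|k] /=; first by rewrite mulr0n !add0r mulr1n; ring.
  by rewrite [_ *+ k.+2]mulrSr !exprS; ring.
exists (\sum_(k < size p) p`_k * e k).
transitivity (\sum_(k < size p) (p`_k * (y ^+ k.-1 *+ k) + p`_k * ((x - y) * e k))).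
  by apply: eq_bigr => k _; rewrite -mulrDr -eE.
rewrite big_split /= mulr_sumr; congr (_ + _); last first.
  by apply: eq_bigr => k _; rewrite mulrCA.
rewrite (@horner_coef_wide _ (size p)); last first.
  by rewrite /deriv; apply: leq_trans (size_poly _ _) (leq_pred _).
case sp: (size p) => [|m]; first by rewrite !big_ord0.
rewrite big_ord_recl mulr0n mulr0 add0r big_ord_recr /=.
rewrite coef_deriv [p`_m.+1]nth_default ?sp // mul0rn mul0r addr0.
by apply: eq_bigr => k _; rewrite coef_deriv mulrnAr mulrnAl.
Qed.

(** Differentiating the recursion of [psum] in the outer variable t gives a
    recursion for the derivatives at (x + y, x * y), solved by the complete
    homogeneous polynomials. *)
Lemma psum_deriv (A : comNzRingType) (x y : A) k :
  let P j := map_poly (horner_eval (x + y)) (psum A j) in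
  (P k).[x * y] = x ^+ k + y ^+ k /\
  (P k.+1)^`().[x * y] = - (complete_hom k x y *+ k.+1).
Proof.
move=> P.
have PS j : P j.+2 = (x + y)%:P * P j.+1 - 'X * P j.
  by rewrite /P /= rmorphB !rmorphM /= map_polyC map_polyX /= /horner_eval hornerX.
have P0 : P 0%N = 2%:R by rewrite /P /= rmorph_nat.
have P1 : P 1%N = (x + y)%:P by rewrite /P /= map_polyC /= /horner_eval hornerX.
have V j : (P j).[x * y] = x ^+ j + y ^+ j /\ (P j.+1).[x * y] = x ^+ j.+1 + y ^+ j.+1.
  elim: j => [|j [IH1 IH2]]; first by rewrite P0 P1 -polyC_natr !hornerC !expr1.
  by split=> //; rewrite PS !hornerE IH1 IH2 !exprS; ring.
have h0 : complete_hom 0 x y = 0 by rewrite /complete_hom big_ord0.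
split; first by case: (V k).
elim/ltn_ind: k => -[|[|k]] IH.
- by rewrite P1 derivC horner0 h0 mul0rn oppr0.
- rewrite PS P0 P1 !(complete_homSr, h0) -polyC_natr !derivE !hornerE.
  by ring.
have [V1 _] := V k.+1.
rewrite PS derivB !derivM derivC derivX !hornerE (IH k.+1) // (IH k) // V1.
have E1 := complete_homSl k.+1 x y; have E2 := complete_homSr k.+1 x y.
have E3 := complete_homSl k x y.
have -> : complete_hom k.+2 x y *+ k.+3 =
  complete_hom k.+2 x y + complete_hom k.+2 x y *+ k.+2 by rewrite mulrS.
rewrite {1}E2 E1 E3 !exprS !mulrS; ring.
Qed.

(** The divided difference u2 of G in its second variable agrees with the
    partial derivative of G modulo the difference of the two arguments. *)
Lemma u2_complete_hom n (A : comNzRingType) (x1 x2 x3 x4 : A) : (0 < n)%N ->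
  exists d, u2 n x1 x2 x3 x4 =
    (x1 * x2 - x3 * x4) * d - complete_hom n x3 x4 *+ n.+1.
Proof.
move=> n0; rewrite /u2.
have [d ->] := ddiff_deriv (map_poly (horner_eval (x3 + x4)) (GG n A))
  (x1 * x2) (x3 * x4).
exists d; rewrite addrC; congr (_ + _).
have [_ <-] := psum_deriv x3 x4 n.
rewrite /GG rmorphB /= derivB hornerD hornerN rmorphMn /= map_polyC derivMn derivC.
by rewrite mul0rn horner0 subr0.
Qed.

(** * Local operators on the complex of a resolution *)

Lemma sign_flip (A : pzRingType) (I : finType) (P : pred I) (b b' : I -> bool) (c : I) :
  P c -> b' c = ~~ b c -> (forall d, d != c -> b' d = b d) ->
  (-1) ^+ (\sum_(d | P d) b' d)%N = - (-1) ^+ (\sum_(d | P d) b d)%N :> A.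
Proof.
move=> Pc bc bd; rewrite (bigD1 c) // [in RHS](bigD1 c) //= bc.
rewrite (eq_bigr (fun d => nat_of_bool (b d))); last by move=> d /andP[_ /bd ->].
by rewrite !exprD; case: (b c); rewrite /= expr1 expr0 !mulN1r ?mul1r ?opprK.
Qed.

Section Local.
Variables (R : realType) (n : nat) (S : shadow).
Local Notation poly_ring := {mpoly R[i][nmark S]}.
Local Notation chain := (chain R S).
Local Notation state := (state S).
Local Notation vertex := (vertex S).
Implicit Types (f g : chain) (t : state) (v w : vertex) (M N : bool -> 'M[poly_ring]_2).
Implicit Types (c : 'I_(ncr S)) (a : 'I_(narc S)).

(** The differential and the maps chi0 and chi1 are assembled from operators
    that act on one tensor factor only: [odd_op] changes the Z/2-degree of a
    crossing, with the Koszul sign, [even_op] keeps it, and [arc_op] changes the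
    degree of an arc.  For a family M of matrices, M p acts on the part of
    degree p. *)
Definition odd_op c M f : chain := [ffun t : state => cr_sign R t c *
  \sum_(k < 2) M (~~ (t.2 c).1) (t.2 c).2 k * f (set_cr t c (~~ (t.2 c).1, k))].

Definition even_op c M f : chain := [ffun t : state =>
  \sum_(k < 2) M (t.2 c).1 (t.2 c).2 k * f (set_cr t c ((t.2 c).1, k))].

Definition arc_op a (m : bool -> poly_ring) f : chain := [ffun t : state =>
  arc_sign R t a * m (~~ t.1 a) * f (set_arc t a (~~ t.1 a))].

Lemma diffE v f : diff n v f = \sum_a arc_op a (arc_map R n a) f
  + \sum_c odd_op c (cr_map R n c (v c)) f.
Proof.
apply/ffunP => t; rewrite !ffunE !sum_ffunE; congr (_ + _);
  by apply: eq_bigr => k _; rewrite ffunE.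
Qed.

Lemma chi0E c f : chi0 n c f = even_op c (U_map R n c) f.
Proof. by []. Qed.

Lemma chi1E c f : chi1 n c f = even_op c (fun p => \adj (U_map R n c p)) f.
Proof. by []. Qed.

Lemma set_cr_id t c c' q : (set_cr t c q).2 c' = if c' == c then q else t.2 c'.
Proof. by rewrite ffunE. Qed.

Lemma set_crC t c c' q q' : c != c' ->
  set_cr (set_cr t c q) c' q' = set_cr (set_cr t c' q') c q.
Proof.
move=> cc'; rewrite /set_cr /=; congr (_, _); apply/ffunP => d; rewrite !ffunE.
by case: (d =P c') => // ->; rewrite eq_sym (negPf cc').
Qed.

Lemma set_crK t c q q' : set_cr (set_cr t c q) c q' = set_cr t c q'.
Proof. by rewrite /set_cr /=; congr (_, _); apply/ffunP => d; rewrite !ffunE; case: eqP. Qed.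

Lemma cr_sign_sq t c : cr_sign R t c * cr_sign R t c = 1.
Proof. by rewrite /cr_sign -expr2 sqrr_sign. Qed.

Lemma cr_sign_set_ge t c c' q : (c' <= c)%N -> cr_sign R (set_cr t c q) c' = cr_sign R t c'.
Proof.
move=> c'c; rewrite /cr_sign /=; congr (_ ^+ (_ + _)).
apply: eq_bigr => d dc'; rewrite ffunE ifN //.
by apply: contraTneq dc' => ->; rewrite -leqNgt.
Qed.

Lemma cr_sign_set_lt t c c' k : (c < c')%N ->
  cr_sign R (set_cr t c (~~ (t.2 c).1, k)) c' = - cr_sign R t c'.
Proof.
move=> cc'; rewrite /cr_sign /= !exprD.
rewrite (sign_flip _ (b := fun d => (t.2 d).1) (c := c)) ?mulrN //.
  by rewrite ffunE eqxx.
by move=> d /negPf dc; rewrite ffunE dc.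
Qed.

(** Exactly one of the two Koszul signs, the one of the later crossing, sees the
    change of degree at the other crossing. *)
Lemma odd_opAC c c' M M' f : c != c' ->
  odd_op c M (odd_op c' M' f) = - odd_op c' M' (odd_op c M f).
Proof.
wlog cc' : c c' M M' / (c < c')%N.
  move=> H ne; case: (ltngtP c c') => [|lt|/val_inj e]; first by move/H; apply.
    by rewrite (H c' c) ?opprK // eq_sym.
  by rewrite e eqxx in ne.
have swap (A : comPzRingType) (p q r s u : A) :
  p * (q * (r * (s * u))) = r * (s * (p * (q * u))) by ring.
move=> ne; have ne' := ne; rewrite eq_sym in ne'; apply/ffunP => t; rewrite !ffunE.
under eq_bigr => k _ do
  rewrite ffunE set_cr_id (negPf ne') cr_sign_set_lt // mulNr mulr_sumr.
under [in RHS]eq_bigr => k _ do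
  rewrite ffunE set_cr_id (negPf ne) cr_sign_set_ge 1?ltnW // mulr_sumr.
rewrite !mulr_sumr -sumrN.
under eq_bigr => k _ do rewrite mulrN mulrN mulr_sumr mulr_sumr -sumrN.
under [in RHS]eq_bigr => k _ do rewrite mulr_sumr mulr_sumr -sumrN.
rewrite [LHS]exchange_big.
apply: eq_bigr => k _; apply: eq_bigr => k' _.
by rewrite (set_crC _ _ _ ne) swap.
Qed.

Lemma cr_sign_set_arc t a c :
  cr_sign R (set_arc t a (~~ t.1 a)) c = - cr_sign R t c.
Proof.
rewrite /cr_sign /= !exprD (sign_flip _ (b := t.1) (c := a)) ?mulNr //.
  by rewrite ffunE eqxx.
by move=> d /negPf da; rewrite ffunE da.
Qed.

Lemma odd_arc_opAC c M a m f :
  odd_op c M (arc_op a m f) = - arc_op a m (odd_op c M f).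
Proof.
apply/ffunP => t; rewrite !ffunE cr_sign_set_arc.
under eq_bigr => k _ do rewrite ffunE.
rewrite !mulr_sumr -sumrN; apply: eq_bigr => k _; rewrite /arc_sign /=.
by rewrite /set_arc /set_cr /=; ring.
Qed.

Lemma even_arc_opC c M a m f :
  even_op c M (arc_op a m f) = arc_op a m (even_op c M f).
Proof.
apply/ffunP => t; rewrite !ffunE.
under eq_bigr => k _ do rewrite ffunE.
rewrite !mulr_sumr; apply: eq_bigr => k _; rewrite /arc_sign /=.
by rewrite /set_arc /set_cr /=; ring.
Qed.

Lemma cr_sign_set_same t c c' k :
  cr_sign R (set_cr t c ((t.2 c).1, k)) c' = cr_sign R t c'.
Proof.
rewrite /cr_sign /=; congr (_ ^+ (_ + _)).
by apply: eq_bigr => d _; rewrite ffunE; case: (d =P c) => // ->.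
Qed.

Lemma even_odd_opC c c' M M' f : c != c' ->
  even_op c M (odd_op c' M' f) = odd_op c' M' (even_op c M f).
Proof.
have swap (A : comPzRingType) (p q r s : A) :
  p * (q * (r * s)) = q * (r * (p * s)) by ring.
move=> ne; have ne' := ne; rewrite eq_sym in ne'; apply/ffunP => t; rewrite !ffunE.
under eq_bigr => k _ do rewrite ffunE set_cr_id (negPf ne') cr_sign_set_same 2!mulr_sumr.
under [in RHS]eq_bigr => k _ do rewrite ffunE set_cr_id (negPf ne) mulr_sumr.
rewrite !mulr_sumr.
under [in RHS]eq_bigr => k _ do rewrite mulr_sumr.
rewrite [LHS]exchange_big.
apply: eq_bigr => k _; apply: eq_bigr => k' _.
by rewrite (set_crC _ _ _ ne) swap.
Qed.

Lemma odd_odd_op c M M' f :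
  odd_op c M (odd_op c M' f) = even_op c (fun p => M (~~ p) *m M' p) f.
Proof.
apply/ffunP => t; rewrite !ffunE.
under eq_bigr => k _ do rewrite ffunE set_cr_id eqxx /= cr_sign_set_ge // negbK mulrCA.
rewrite -mulr_sumr mulrA cr_sign_sq mul1r.
under [RHS]eq_bigr => k _ do rewrite mxE mulr_suml.
rewrite exchange_big /=; apply: eq_bigr => k _; rewrite mulr_sumr.
by apply: eq_bigr => k' _; rewrite set_crK mulrA.
Qed.

Lemma even_odd_op c N M f :
  even_op c N (odd_op c M f) = odd_op c (fun p => N (~~ p) *m M p) f.
Proof.
apply/ffunP => t; rewrite !ffunE.
under eq_bigr => k _ do rewrite ffunE set_cr_id eqxx /= cr_sign_set_ge // mulrCA.
rewrite -mulr_sumr; congr (_ * _).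
under [RHS]eq_bigr => k _ do rewrite mxE mulr_suml.
rewrite exchange_big /=; apply: eq_bigr => k _; rewrite mulr_sumr.
by apply: eq_bigr => k' _; rewrite set_crK negbK mulrA.
Qed.

Lemma odd_even_op c N M f :
  odd_op c M (even_op c N f) = odd_op c (fun p => M p *m N p) f.
Proof.
apply/ffunP => t; rewrite !ffunE; congr (_ * _).
under eq_bigr => k _ do rewrite ffunE set_cr_id eqxx /=.
under [RHS]eq_bigr => k _ do rewrite mxE mulr_suml.
rewrite exchange_big /=; apply: eq_bigr => k _; rewrite mulr_sumr.
by apply: eq_bigr => k' _; rewrite set_crK mulrA.
Qed.

Lemma odd_opD c M f g : odd_op c M (f + g) = odd_op c M f + odd_op c M g.
Proof.
apply/ffunP => t; rewrite !ffunE -mulrDr -big_split /=; congr (_ * _).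
by apply: eq_bigr => k _; rewrite ffunE mulrDr.
Qed.

Lemma even_opD c M f g : even_op c M (f + g) = even_op c M f + even_op c M g.
Proof.
apply/ffunP => t; rewrite !ffunE -big_split /=.
by apply: eq_bigr => k _; rewrite ffunE mulrDr.
Qed.

Lemma arc_opD a m f g : arc_op a m (f + g) = arc_op a m f + arc_op a m g.
Proof. by apply/ffunP => t; rewrite !ffunE mulrDr. Qed.

Lemma odd_op_pscale c M q f : odd_op c M (pscale q f) = pscale q (odd_op c M f).
Proof.
apply/ffunP => t; rewrite !ffunE mulrCA; congr (_ * _); rewrite mulr_sumr.
by apply: eq_bigr => k _; rewrite ffunE mulrCA.
Qed.

Lemma even_op_pscale c M q f : even_op c M (pscale q f) = pscale q (even_op c M f).
Proof.
apply/ffunP => t; rewrite !ffunE mulr_sumr.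
by apply: eq_bigr => k _; rewrite ffunE mulrCA.
Qed.

Lemma arc_op_pscale a m q f : arc_op a m (pscale q f) = pscale q (arc_op a m f).
Proof. by apply/ffunP => t; rewrite !ffunE mulrCA. Qed.

Lemma odd_op_sum c M (I : Type) (r : seq I) (P : pred I) (F : I -> chain) :
  odd_op c M (\sum_(i <- r | P i) F i) = \sum_(i <- r | P i) odd_op c M (F i).
Proof.
apply: (big_morph _ (odd_opD c M)); apply/ffunP => t; rewrite !ffunE.
by rewrite big1 ?mulr0 // => k _; rewrite ffunE mulr0.
Qed.

Lemma even_op_sum c M (I : Type) (r : seq I) (P : pred I) (F : I -> chain) :
  even_op c M (\sum_(i <- r | P i) F i) = \sum_(i <- r | P i) even_op c M (F i).
Proof.
apply: (big_morph _ (even_opD c M)); apply/ffunP => t; rewrite !ffunE.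
by rewrite big1 // => k _; rewrite ffunE mulr0.
Qed.

(** The operators at the other pieces commute with an even operator at c, so
    only the matrices at c matter. *)
Lemma even_op_chain v w c N f : (forall d : 'I_(ncr S), d != c -> w d = v d) ->
  (forall p, N (~~ p) *m cr_map R n c (v c) p = cr_map R n c (w c) p *m N p) ->
  even_op c N (diff n v f) = diff n w (even_op c N f).
Proof.
move=> wv NM; rewrite !diffE even_opD !even_op_sum; congr (_ + _).
  by apply: eq_bigr => a _; rewrite even_arc_opC.
apply: eq_bigr => d _; have [->|dc] := eqVneq d c; last first.
  by rewrite wv // even_odd_opC // eq_sym.
rewrite even_odd_op odd_even_op; apply/ffunP => t; rewrite !ffunE.
by congr (_ * _); apply: eq_bigr => k _; rewrite NM.
Qed.

(** The operators at the other pieces anticommute with an odd operator at c, so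
    a homotopy of the matrix factorization at c is one of the whole complex. *)
Lemma odd_op_homotopy v c K f :
  odd_op c K (diff n v f) + diff n v (odd_op c K f) =
  even_op c (fun p => K (~~ p) *m cr_map R n c (v c) p
                     + cr_map R n c (v c) (~~ p) *m K p) f.
Proof.
rewrite !diffE odd_opD !odd_op_sum addrACA -!big_split /=.
rewrite big1 ?add0r => [|a _]; last by rewrite odd_arc_opAC addNr.
rewrite (bigD1 c) //= [X in _ + X]big1 ?addr0 => [|d dc]; last first.
  by rewrite (odd_opAC _ _ _ dc) addrN.
rewrite !odd_odd_op; apply/ffunP => t; rewrite !ffunE -big_split /=.
by apply: eq_bigr => k _; rewrite -mulrDl; congr (_ * _); rewrite [RHS]mxE.
Qed.

Lemma even_op_scalar c q f : even_op c (fun=> q%:M) f = pscale q f.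
Proof.
apply/ffunP => t; rewrite !ffunE (bigD1 (t.2 c).2) //= big1 => [|k kc]; last first.
  by rewrite mxE eq_sym (negPf kc) mul0r.
rewrite mxE eqxx mulr1n addr0; congr (_ * f _).
case: t => t1 t2 /=; congr (_, _); apply/ffunP => d; rewrite ffunE /=.
by case: eqP => // ->; case: (t2 c).
Qed.

End Local.

(** * Chain maps and null-homotopies *)

Section Mx2.
Variable A : comPzRingType.
Implicit Types a b c d : A.

Lemma mx2M a b c d a' b' c' d' : mx2 a b c d *m mx2 a' b' c' d' =
  mx2 (a * a' + b * c') (a * b' + b * d') (c * a' + d * c') (c * b' + d * d').
Proof.
apply/matrixP => i j; rewrite !mxE !big_ord_recl big_ord0 addr0 !mxE /=.
by case: ifP => _; case: ifP.
Qed.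

Lemma mx2D a b c d a' b' c' d' : mx2 a b c d + mx2 a' b' c' d' =
  mx2 (a + a') (b + b') (c + c') (d + d').
Proof. by apply/matrixP => i j; rewrite !mxE; case: ifP => _; case: ifP. Qed.

Lemma mx2_scalar a : a%:M = mx2 a 0 0 a.
Proof.
apply/matrixP => i j; rewrite !mxE.
by case: i j => [[|[|//]] Hi] [[|[|//]] Hj] /=; rewrite ?mulr0n ?mulr1n.
Qed.

End Mx2.

Lemma adj_mx2 (A : comNzRingType) (a b c d : A) : \adj (mx2 a b c d) = mx2 d (- b) (- c) a.
Proof.
apply/matrixP => i j; rewrite mxE /cofactor det_mx11 !mxE.
case: i j => [[|[|//]] Hi] [[|[|//]] Hj] /=;
  rewrite ?expr1 ?expr0 ?mulN1r ?mul1r //.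
by rewrite -signr_odd mul1r.
Qed.

Section MF.
Variables (A : comNzRingType) (n : nat) (x1 x2 x3 x4 : A).
Let v1 := u1 n x1 x2 x3 x4.
Let v2 := u2 n x1 x2 x3 x4.
Let a := aa n x1 x2 x3 x4.

(** These are the matrices of [cr_map] and [U_map] at arbitrary elements of a
    commutative ring, where the identities between them do not depend on which
    marks coincide. *)
Definition P_mx (p : bool) : 'M[A]_2 :=
  if p then mx2 (x1 - x4) (x2 - x3) (ppi n x2 x3) (- ppi n x1 x4)
  else mx2 (ppi n x1 x4) (x2 - x3) (ppi n x2 x3) (x4 - x1).

Definition Q_mx (p : bool) : 'M[A]_2 :=
  if p then mx2 (x1 + x2 - x3 - x4) (x1 * x2 - x3 * x4) v2 (- v1)
  else mx2 v1 (x1 * x2 - x3 * x4) v2 (x3 + x4 - x1 - x2).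

Definition U_mx (p : bool) : 'M[A]_2 :=
  if p then mx2 x4 (- x2) (-1) 1 else mx2 (x4 - x2) 0 a 1.

Lemma U_mx_intertwines p : U_mx (~~ p) *m P_mx p = Q_mx p *m U_mx p.
Proof.
have [E14 E23] := ppi_splitP n x1 x2 x3 x4.
rewrite /P_mx /Q_mx /U_mx E14 E23 -/v1 -/v2 -/a.
by clearbody v1 v2 a; case: p; rewrite /= !mx2M; congr mx2; ring.
Qed.

Lemma adj_U_mx_intertwines p :
  \adj (U_mx (~~ p)) *m Q_mx p = P_mx p *m \adj (U_mx p).
Proof.
have [E14 E23] := ppi_splitP n x1 x2 x3 x4.
rewrite /P_mx /Q_mx /U_mx E14 E23 -/v1 -/v2 -/a.
by clearbody v1 v2 a; case: p; rewrite /= !adj_mx2 !mx2M; congr mx2; ring.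
Qed.

(** The homotopy is the derivative of the matrices Q in t' = x3 * x4, at fixed
    x1, x2 and x3 + x4: the only entries that involve t' are x1 * x2 - t' and u2,
    and d plays the role of the derivative of u2. *)
Lemma complete_hom_mx_homotopy : (0 < n)%N ->
  exists K : bool -> 'M[A]_2, forall p,
    K (~~ p) *m Q_mx p + Q_mx (~~ p) *m K p = (complete_hom n x3 x4 *+ n.+1)%:M.
Proof.
move=> n0; have [d v2E] := u2_complete_hom x1 x2 x3 x4 n0.
exists (fun=> mx2 0 (-1) d 0) => p.
have -> : complete_hom n x3 x4 *+ n.+1 = (x1 * x2 - x3 * x4) * d - v2.
  by rewrite /v2 v2E; ring.
rewrite mx2_scalar /Q_mx; clearbody v1 v2 a.
by case: p; rewrite /= !mx2M mx2D; congr mx2; ring.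
Qed.

End MF.

Section Resolution.
Variables (R : realType) (n : nat) (S : shadow).
Local Notation poly_ring := {mpoly R[i][nmark S]}.
Local Notation chain := (chain R S).
Local Notation state := (state S).
Local Notation vertex := (vertex S).
Implicit Types (f g : chain) (v w : vertex) (c : 'I_(ncr S)) (q : poly_ring).

(** By definition [homologous v x y] is [boundary v (x - y)]. *)
Definition boundary v f : Prop := exists z, f = diff n v z.

Lemma chi0_diff c v w f : v c = false -> w c = true ->
  (forall d : 'I_(ncr S), d != c -> w d = v d) ->
  chi0 n c (diff n v f) = diff n w (chi0 n c f).
Proof.
move=> vc wc wv; rewrite !chi0E; apply: even_op_chain => // p; rewrite vc wc.
exact: (U_mx_intertwines n ('X_(out c false) : poly_ring) 'X_(out c true)
  'X_(inc c true) 'X_(inc c false) p).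
Qed.

Lemma chi1_diff c v w f : v c = true -> w c = false ->
  (forall d : 'I_(ncr S), d != c -> w d = v d) ->
  chi1 n c (diff n v f) = diff n w (chi1 n c f).
Proof.
move=> vc wc wv; rewrite !chi1E; apply: even_op_chain => // p; rewrite vc wc.
exact: (adj_U_mx_intertwines n ('X_(out c false) : poly_ring) 'X_(out c true)
  'X_(inc c true) 'X_(inc c false) p).
Qed.

Lemma diffD v f g : diff n v (f + g) = diff n v f + diff n v g.
Proof.
rewrite !diffE addrACA -!big_split /=; congr (_ + _).
  by apply: eq_bigr => k _; rewrite arc_opD.
by apply: eq_bigr => k _; rewrite odd_opD.
Qed.

Lemma pscaleDr q f g : pscale q (f + g) = pscale q f + pscale q g.
Proof. by apply/ffunP => t; rewrite !ffunE mulrDr. Qed.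

Lemma pscaleDl q q' f : pscale (q + q') f = pscale q f + pscale q' f.
Proof. by apply/ffunP => t; rewrite !ffunE mulrDl. Qed.

Lemma pscaleA q q' f : pscale q (pscale q' f) = pscale (q * q') f.
Proof. by apply/ffunP => t; rewrite !ffunE mulrA. Qed.

Lemma pscale1 f : pscale 1 f = f.
Proof. by apply/ffunP => t; rewrite !ffunE mul1r. Qed.

Lemma pscale0 f : pscale 0 f = 0.
Proof. by apply/ffunP => t; rewrite !ffunE mul0r. Qed.

Lemma pscaler0 q : pscale q 0 = 0 :> chain.
Proof. by apply/ffunP => t; rewrite !ffunE mulr0. Qed.

Lemma pscale_sum q (I : Type) (r : seq I) (P : pred I) (F : I -> chain) :
  pscale q (\sum_(i <- r | P i) F i) = \sum_(i <- r | P i) pscale q (F i).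
Proof. exact: (big_morph _ (pscaleDr q) (pscaler0 q)). Qed.

Lemma diff_pscale v q f : diff n v (pscale q f) = pscale q (diff n v f).
Proof.
rewrite !diffE pscaleDr !pscale_sum; congr (_ + _).
  by apply: eq_bigr => k _; rewrite arc_op_pscale.
by apply: eq_bigr => k _; rewrite odd_op_pscale.
Qed.

Lemma chi0_pscale c q f : chi0 n c (pscale q f) = pscale q (chi0 n c f).
Proof. by rewrite !chi0E even_op_pscale. Qed.

Lemma chi1_pscale c q f : chi1 n c (pscale q f) = pscale q (chi1 n c f).
Proof. by rewrite !chi1E even_op_pscale. Qed.

Lemma boundaryD v f g : boundary v f -> boundary v g -> boundary v (f + g).
Proof. by move=> [y ->] [z ->]; exists (y + z); rewrite diffD. Qed.

Lemma boundary_pscale v q f : boundary v f -> boundary v (pscale q f).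
Proof. by move=> [z ->]; exists (pscale q z); rewrite diff_pscale. Qed.

Lemma boundaryN v f : boundary v f -> boundary v (- f).
Proof.
have -> : - f = pscale (-1) f by apply/ffunP => t; rewrite !ffunE mulN1r.
exact: boundary_pscale.
Qed.

Lemma diff0 v : diff n v (0 : chain) = 0.
Proof. by rewrite -[0 in LHS](pscale0 0) diff_pscale pscale0. Qed.

Lemma boundary0 v : boundary v 0.
Proof. by exists 0; rewrite diff0. Qed.

Lemma boundary_sum v (I : Type) (r : seq I) (P : pred I) (F : I -> chain) :
  (forall i, P i -> boundary v (F i)) -> boundary v (\sum_(i <- r | P i) F i).
Proof. by move=> FP; elim/big_ind: _ => //; [exact: boundary0 | exact: boundaryD]. Qed.

(** The polynomial is (x3^n - x4^n) / (x3 - x4), which vanishes at two distinct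
    n-th roots of unity, the values of the two incoming marks of a wide edge.
    Concretely, the homotopy of [complete_hom_mx_homotopy] extends to the whole
    complex, and n + 1 is invertible in the coefficients. *)
Lemma complete_hom_boundary v c f : (0 < n)%N -> v c = true -> cycle_at n v f ->
  boundary v (pscale (complete_hom n 'X_(inc c true) 'X_(inc c false)) f).
Proof.
move=> n0 vc cyc.
have [K KP] := complete_hom_mx_homotopy ('X_(out c false) : poly_ring) 'X_(out c true)
  'X_(inc c true) 'X_(inc c false) n0.
have := odd_op_homotopy n v c K f; rewrite cyc.
have -> : odd_op c K 0 = 0 :> chain.
  by rewrite -[0 in LHS](pscale0 0) odd_op_pscale pscale0.
set h := complete_hom _ _ _ in KP *; rewrite add0r.
have -> : even_op c (fun p => K (~~ p) *m cr_map R n c (v c) p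
                     + cr_map R n c (v c) (~~ p) *m K p) f =
          even_op c (fun=> (h *+ n.+1)%:M) f.
  by apply/ffunP => t; rewrite !ffunE; apply: eq_bigr => k _; rewrite vc -(KP (t.2 c).1).
rewrite even_op_scalar => E.
have -> : pscale h f = pscale (n.+1%:R^-1)%:MP (pscale (h *+ n.+1) f).
  rewrite pscaleA -[h *+ _]mulr_natr mulrCA -mpolyC_nat -mpolyCM mulVf ?mulr1 //.
  by rewrite pnatr_eq0.
by rewrite -E; apply: boundary_pscale; exists (odd_op c K f).
Qed.

End Resolution.

(** * The action of the marks on the cycles g_i *)

Section Eigen.
Variables (R : realType) (n : nat) (S : shadow).
Local Notation poly_ring := {mpoly R[i][nmark S]}.
Local Notation x_ m := ('X_m : poly_ring).
Local Notation zeta i := (xi R n ^+ i).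

Lemma xi_powE k : xi R n ^+ k =
  Complex (trigo.cos (2 * trigo.pi / n%:R *+ k)) (trigo.sin (2 * trigo.pi / n%:R *+ k)).
Proof.
elim: k => [|k IH]; first by rewrite mulr0n trigo.cos0 trigo.sin0.
rewrite exprS IH /xi [_ *+ k.+1]mulrS trigo.cosD trigo.sinD.
by apply/eqP; rewrite eq_complex /=; apply/andP; split; apply/eqP; ring.
Qed.

Lemma xi_unity : (0 < n)%N -> xi R n ^+ n = 1.
Proof.
move=> n0; rewrite xi_powE -mulr_natr divfK ?pnatr_eq0 -?lt0n //.
by rewrite mulr_natl trigo.cos2pi trigo.sin2pi.
Qed.

Lemma zeta_unity i : (0 < n)%N -> zeta i ^+ n = 1.
Proof. by move=> n0; rewrite exprAC xi_unity ?expr1n. Qed.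

Lemma gpolyK i : (0 < n)%N -> ('X - (zeta i)%:P) * gpoly R n i = 'X ^+ n - 1.
Proof.
move=> n0; have /factor_theorem [p E] : root ('X ^+ n - 1) (zeta i).
  by rewrite rootE !hornerE zeta_unity // subrr.
by rewrite /gpoly E mulpK ?polyXsubC_eq0 // mulrC.
Qed.

Lemma circle_idealD p q : circle_ideal n (S := S) (R := R) p ->
  circle_ideal n q -> circle_ideal n (p + q).
Proof.
move=> [b [d ->]] [b' [d' ->]].
exists (fun i j => b i j + b' i j), (fun i => d i + d' i).
rewrite addrACA -[X in X + _ = _]big_split -[X in _ + X = _]big_split /=.
congr (_ + _); apply: eq_bigr => i _.
  by rewrite -big_split /=; apply: eq_bigr => j _; rewrite mulrDl.
by rewrite mulrDl.
Qed.

Lemma circle_idealM r p : circle_ideal n (S := S) (R := R) p -> circle_ideal n (r * p).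
Proof.
move=> [b [d ->]]; exists (fun i j => r * b i j), (fun i => r * d i).
rewrite mulrDr !mulr_sumr; congr (_ + _); apply: eq_bigr => i _; last by rewrite mulrA.
by rewrite mulr_sumr; apply: eq_bigr => j _; rewrite mulrA.
Qed.

Lemma circle_ideal_sub m e : same_circle m e ->
  circle_ideal n (x_ m - x_ e).
Proof.
move=> me; exists (fun i j => ((i == m) && (j == e))%:R), (fun=> 0).
rewrite [X in _ = _ + X]big1 => [|i _]; last by rewrite mul0r.
rewrite addr0 (bigD1 m) //= (bigD1 e) //= !eqxx mul1r !big1 ?addr0 //.
  by move=> i /negPf im; rewrite big1 // => j _; rewrite im mul0r.
by move=> j /andP[_ /negPf je]; rewrite je mul0r.
Qed.

Lemma circle_ideal_pow m : circle_ideal n (x_ m ^+ n - 1).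
Proof.
exists (fun _ _ => 0), (fun i => (i == m)%:R).
rewrite [X in _ = X + _]big1 => [|i _]; last by rewrite big1 // => j _; rewrite mul0r.
rewrite add0r (bigD1 m) //= eqxx mul1r big1 ?addr0 // => i /negPf ->.
by rewrite mul0r.
Qed.

(** Modulo the ideal the mark m may be replaced by the representative e of its
    circle, and (x_e - xi^i) divides x_e^n - 1 with quotient the factor of g_i at
    e. *)
Lemma g_ideal i m : (0 < n)%N -> circle_ideal n ((x_ m - (zeta i)%:MP) *
  \prod_(e | circle_rep e) (map_poly (@mpolyC _ _) (gpoly R n i)).[x_ e]).
Proof.
move=> n0; pose F e := (map_poly (@mpolyC _ _) (gpoly R n i)).[x_ e].
rewrite (eq_bigr F) //.
have symS : connect_sym (symc (@smooth_step S)).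
  by apply: sym_connect_sym => x y; rewrite /symc /= orbC.
pose e := fingraph.root (symc (@smooth_step S)) m.
have re : circle_rep e by exact: roots_root.
have -> : x_ m - (zeta i)%:MP = (x_ m - x_ e) + (x_ e - (zeta i)%:MP) by ring.
rewrite mulrDl; apply: circle_idealD.
  by rewrite mulrC; apply/circle_idealM/circle_ideal_sub/connect_root.
rewrite (bigD1 e) //= mulrA mulrC; apply: circle_idealM.
have -> : (x_ e - (zeta i)%:MP) * F e =
          (map_poly (@mpolyC _ _) (('X - (zeta i)%:P) * gpoly R n i)).[x_ e].
  by rewrite rmorphM rmorphB /= map_polyX map_polyC hornerM !hornerE.
rewrite gpolyK // rmorphB rmorphXn /= map_polyX rmorph1 !hornerE.
exact: circle_ideal_pow.
Qed.

Definition acts_on_g i (q : poly_ring) (a : R[i]) : Prop :=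
  boundary n (vertex0 S) (pscale (q - a%:MP) (g_cycle R n S i)).

Lemma acts_mark i m : (0 < n)%N -> acts_on_g i (x_ m) (zeta i).
Proof.
move=> n0; rewrite /acts_on_g /g_cycle pscaleA.
have [[x xP]|noU] := pselect (exists x, is_unit_cycle n (S := S) (R := R) x).
  have : is_unit_cycle n (unit_cycle R n S) by apply: xgetPex; exists x.
  move=> [_ _ /(_ ((x_ m - (zeta i)%:MP) * \prod_(e | circle_rep e)
    (map_poly (@mpolyC _ _) (gpoly R n i)).[x_ e])) [_ H] _].
  by have [z] := H (g_ideal i m n0); rewrite subr0 => ->; exists z.
(* Without a generator satisfying [is_unit_cycle] the default value 0 is chosen,
   so that g_i = 0. *)
have -> : unit_cycle R n S = 0.
  by apply: xgetPN => x xP; apply: noU; exists x.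
by rewrite -[0](pscale0 0) pscaleA mulr0 pscale0; apply: boundary0.
Qed.

Lemma actsD i q q' a a' : acts_on_g i q a -> acts_on_g i q' a' ->
  acts_on_g i (q + q') (a + a').
Proof.
move=> H H'; rewrite /acts_on_g mpolyCD opprD addrACA pscaleDl.
exact: boundaryD.
Qed.

Lemma actsM i q q' a a' : acts_on_g i q a -> acts_on_g i q' a' ->
  acts_on_g i (q * q') (a * a').
Proof.
move=> H H'; rewrite /acts_on_g mpolyCM.
have -> : q * q' - a%:MP * a'%:MP = q' * (q - a%:MP) + a%:MP * (q' - a'%:MP) by ring.
by rewrite pscaleDl -!pscaleA; apply: boundaryD; apply: boundary_pscale.
Qed.

Lemma actsC i a : acts_on_g i a%:MP a.
Proof. by rewrite /acts_on_g subrr pscale0; apply: boundary0. Qed.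

Lemma actsX i q a k : acts_on_g i q a -> acts_on_g i (q ^+ k) (a ^+ k).
Proof.
move=> H; elim: k => [|k IH]; last by rewrite !exprS; apply: actsM.
by rewrite !expr0 -mpolyC1; apply: actsC.
Qed.

Lemma acts_complete_hom i m m' : (0 < n)%N ->
  acts_on_g i (complete_hom n (x_ m) (x_ m')) (n%:R * zeta i ^+ n.-1).
Proof.
move=> n0; have -> : n%:R * zeta i ^+ n.-1 = complete_hom n (zeta i) (zeta i).
  rewrite /complete_hom -[n in n%:R]card_ord -sumr_const mulr_suml; apply: eq_bigr => l _.
  by rewrite mul1r -exprD subnK // -ltnS prednK.
rewrite /complete_hom; elim/big_ind2: _ => [|q a q' a' H H'|l _].
- by rewrite -mpolyC0; apply: actsC.
- exact: actsD.
- by apply: actsM; apply/actsX/acts_mark.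
Qed.

Lemma complete_hom_eigenvalue_neq0 i : (0 < n)%N -> n%:R * zeta i ^+ n.-1 != 0.
Proof.
move=> n0; rewrite mulf_neq0 ?pnatr_eq0 -?lt0n // expf_neq0 //.
apply/eqP => z0; have /eqP := zeta_unity i n0.
by rewrite z0 expr0n -[(n == _)%N]negbK -lt0n n0 /= eq_sym oner_eq0.
Qed.

Lemma msize_complete_hom m m' : (msize (complete_hom n (x_ m) (x_ m')) <= n)%N.
Proof.
rewrite /complete_hom; apply: leq_trans (mmeasure_sum _ _ _ _) _; apply/bigmax_leqP => l _.
rewrite !mpolyXn -mpolyXD msizeX mdegD !mdegMn !mdeg1 !mul1n subnK.
  by rewrite prednK // (leq_ltn_trans _ (ltn_ord l)).
by rewrite -ltnS prednK // (leq_ltn_trans _ (ltn_ord l)).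
Qed.

End Eigen.

(** * Least elements of sets of integers *)

Lemma int_least (A : int -> Prop) (L a : int) : A a -> (forall j, A j -> L <= j) ->
  exists m, A m /\ forall j, A j -> m <= j.
Proof.
move=> Aa AL; pose p (k : nat) := `[< A (L + k%:Z) >].
have shift j : A j -> p `|j - L|%N.
  by move=> Aj; apply/asboolP; rewrite gez0_abs ?subr_ge0 ?AL // subrKC.
have exp : exists k, p k by exists `|a - L|%N; apply: shift.
case: (ex_minnP exp) => m /asboolP Am mP; exists (L + m%:Z); split=> // j Aj.
by rewrite addrC -lerBrDr -(@gez0_abs (j - L)) ?subr_ge0 ?AL // lez_nat mP ?shift.
Qed.

(** The default value is the one of [qgr]. *)
Definition least (A : int -> Prop) : int :=
  xget 0 [set j | A j /\ forall j', A j' -> j <= j']%classic.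

Lemma leastE (A : int -> Prop) m : A m -> (forall j, A j -> m <= j) -> least A = m.
Proof.
move=> Am mP; have [] : [set j | A j /\ forall j', A j' -> j <= j']%classic (least A).
  by apply: xgetPex; exists m.
by move=> Al lP; apply/eqP; rewrite eq_le lP //= mP.
Qed.

(** The two inclusions make the existence of a least element equivalent for A
    and B; when there is none, [least] has the same default value on both. *)
Lemma least_close (A B : int -> Prop) (d : int) : 0 <= d ->
  (forall j, A j -> B j) -> (forall j, B j -> A (j + d)) ->
  `|least B - least A| <= d.
Proof.
move=> d0 AB BA.
have [[b [Bb bP]]|noB] := pselect (exists b, B b /\ forall j, B j -> b <= j).
  have [|a [Aa aP]] := @int_least A b _ (BA _ Bb); first by move=> j /AB /bP.
  rewrite (leastE Bb bP) (leastE Aa aP) distrC ger0_norm; last first.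
    by rewrite subr_ge0; apply/bP/AB.
  by rewrite lerBlDl; apply/aP/BA.
have noA : ~ exists a, A a /\ forall j, A j -> a <= j.
  move=> [a [Aa aP]]; apply: noB; apply: (@int_least B (a - d) a); first exact: AB.
  by move=> j /BA /aP; rewrite lerBlDr.
have E C : ~ (exists b, C b /\ forall j, C j -> b <= j) -> least C = 0.
  by move=> noC; apply: xgetPN => m [Cm mP]; apply: noC; exists m.
by rewrite !E // subrr normr0.
Qed.

(** * Maps between the cubes of two diagrams *)

Section Transfer.
Variables (R : realType) (n : nat) (S : shadow) (wf : well_formed S).
Variables (P P' : 'I_(ncr S) -> bool) (c : 'I_(ncr S)).
Hypotheses (Pc : P' c = ~~ P c) (Pd : forall d : 'I_(ncr S), d != c -> P' d = P d).
Local Notation poly_ring := {mpoly R[i][nmark S]}.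
Local Notation chain := (chain R S).
Local Notation vertex := (vertex S).
Local Notation family := {ffun vertex -> chain}.
Let D := @Diagram S P wf.
Let D' := @Diagram S P' wf.
Variable q : poly_ring.
(* When c is negative in the source diagram, its edges are chi1 in the source
   and chi0 in the target, and both have to vanish after multiplication by q. *)
Hypothesis qK : P c = false -> forall (v : vertex) (f : chain), v c = true ->
  cycle_at n v f -> boundary n v (pscale q f).

Definition edge (Q : 'I_(ncr S) -> bool) d (f : chain) : chain :=
  if Q d then chi0 n d f else chi1 n d f.

Lemma edge_pscale Q d r f : edge Q d (pscale r f) = pscale r (edge Q d f).
Proof. by rewrite /edge; case: ifP; rewrite ?chi0_pscale ?chi1_pscale. Qed.

Lemma edge0 Q d : edge Q d 0 = 0.
Proof. by rewrite -[0 in LHS](pscaler0 0) edge_pscale pscale0. Qed.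

Lemma mulrz_sign (f : chain) k : f *~ ((-1) ^+ k) = pscale ((-1) ^+ k) f.
Proof.
rewrite -signr_odd -[in RHS]signr_odd; case: (odd k); rewrite ?expr0 ?pscale1 //.
by rewrite !expr1 mulrN1z; apply/ffunP => t; rewrite !ffunE mulN1r.
Qed.

Definition flipv (v : vertex) d : vertex := [ffun e => if e == d then ~~ v e else v e].

Definition sign_below (Q : 'I_(ncr S) -> bool) (v : vertex) (d : 'I_(ncr S)) : poly_ring :=
  (-1) ^+ (\sum_(e < ncr S | (e < d)%N) (v e == Q e))%N.

Definition sign_above (Q : 'I_(ncr S) -> bool) (v : vertex) (d : 'I_(ncr S)) : poly_ring :=
  (-1) ^+ (\sum_(e < ncr S | (d < e)%N) (v e == Q e))%N.

(** The height at c differs between the two cubes, which changes the signs of the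
    edges at the crossings after c; [sign_above] compensates this. *)
Definition transfer (X : family) : family :=
  [ffun v : vertex => if v c then 0 else pscale (sign_above P v c * q) (X v)].

Lemma transferE (X : family) (v : vertex) :
  transfer X v = if v c then 0 else pscale (sign_above P v c * q) (X v).
Proof. by rewrite ffunE. Qed.

Lemma cube_diffE (Q : 'I_(ncr S) -> bool) (X : family) (v : vertex) :
  cube_diff n (D := @Diagram S Q wf) X v = \sum_d
    if v d == Q d then pscale (sign_below Q v d) (edge Q d (X (flipv v d))) else 0.
Proof.
rewrite ffunE big_mkcond; apply: eq_bigr => d _; rewrite /height_bit /=.
by case: ifP => // _; rewrite -mulrz_sign /edge; case: ifP.
Qed.

Lemma transfer_sign (v : vertex) d : d != c ->
  sign_above P v c * sign_below P v d = sign_below P' v d * sign_above P (flipv v d) c.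
Proof.
move=> dc; case: (ltngtP c d) => [cd|dltc|/val_inj e]; last by rewrite e eqxx in dc.
- rewrite /sign_below.
  rewrite [X in _ = X * _](sign_flip _ (b := fun e => v e == P e) (c := c)) //;
    first last.
  + by move=> e /Pd ->.
  + by rewrite Pc; case: (v c); case: (P c).
  rewrite /sign_above.
  rewrite [X in _ = _ * X](sign_flip _ (b := fun e => v e == P e) (c := d)) //;
    first last.
  + by move=> e /negPf ed; rewrite ffunE ed.
  + by rewrite ffunE eqxx; case: (v d); case: (P d).
  by rewrite mulrNN mulrC.
- rewrite mulrC /sign_below /sign_above; congr (_ ^+ _ * _ ^+ _).
  + apply: eq_bigr => e ed; rewrite Pd //.
    by apply: contraTneq ed => ->; rewrite -leqNgt ltnW.
  + apply: eq_bigr => e ce; rewrite ffunE ifN //.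
    by apply: contraTneq ce => ->; rewrite -leqNgt ltnW.
Qed.

(** The edges at the crossings other than c match by [transfer_sign].  If c is
    positive in the source, the edges at c end at killed components in the source
    and start at killed components in the target.  Otherwise they are composed
    with q times a cycle of a 1-resolution, which is a boundary. *)
Lemma transfer_chain (X : family) : is_family n (D := D) X -> forall v : vertex,
  boundary n v (transfer (cube_diff n (D := D) X) v - cube_diff n (D := D') (transfer X) v).
Proof.
move=> famX v; rewrite transferE !cube_diffE.
have flip_c d : d != c -> flipv v d c = v c.
  by move=> dc; rewrite ffunE eq_sym (negPf dc).
have flipcc : flipv v c c = ~~ v c by rewrite ffunE eqxx.
have flip_ne e : e != c -> v e = flipv v c e.
  by move=> /negPf ec; rewrite ffunE ec.
case vc : (v c).
  rewrite sub0r -sumrN; apply: boundary_sum => d _; apply: boundaryN; rewrite transferE.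
  have [->|dc] := eqVneq d c; last first.
    by rewrite flip_c // vc edge0; case: ifP => _; rewrite ?pscaler0; apply: boundary0.
  rewrite vc; case: ifP => [/eqP Pc'|_]; last exact: boundary0.
  have Pcf : P c = false by move: Pc'; rewrite Pc; case: (P c).
  rewrite flipcc vc /= /edge -Pc' chi0_pscale -pscaleA.
  apply/boundary_pscale/boundary_pscale/qK => //.
  have fc : flipv v c c = false by rewrite flipcc vc.
  rewrite /cycle_at -(chi0_diff n (X (flipv v c)) fc vc flip_ne) famX.
  by rewrite -[0](pscale0 0) chi0_pscale !pscale0.
rewrite pscale_sum -sumrB; apply: boundary_sum => d _.
have [->|dc] := eqVneq d c; last first.
  rewrite Pd // transferE flip_c // vc; case: ifP => _; last first.
    by rewrite pscaler0 subrr; apply: boundary0.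
  have E : sign_above P v c * q * sign_below P v d =
           sign_below P' v d * (sign_above P (flipv v d) c * q).
    by rewrite mulrA -(transfer_sign v dc) mulrAC.
  have -> : edge P' d = edge P d by rewrite /edge Pd.
  by rewrite edge_pscale !pscaleA E subrr; apply: boundary0.
rewrite vc transferE flipcc vc /= edge0 pscaler0 if_same subr0.
case: ifP => [/eqP/esym Pcf|_]; last by rewrite pscaler0; apply: boundary0.
rewrite /edge Pcf pscaleA -mulrA [q * _]mulrC mulrA -pscaleA -chi1_pscale.
have fc : flipv v c c = true by rewrite flipcc vc.
have [z ->] := qK Pcf fc (famX _).
rewrite (chi1_diff n z fc vc flip_ne).
by apply: boundary_pscale; exists (chi1 n c z).
Qed.

Lemma transferB (X Y : family) : transfer (X - Y) = transfer X - transfer Y.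
Proof.
apply/ffunP => v; apply/ffunP => t; rewrite !ffunE; case: ifP => _; rewrite !ffunE ?subrr //.
by rewrite mulrBr.
Qed.

Lemma transfer_boundary (X : family) (v : vertex) :
  boundary n v (X v) -> boundary n v (transfer X v).
Proof.
by rewrite transferE; case: ifP => _ H; [apply: boundary0 | apply: boundary_pscale].
Qed.

Lemma transfer_family (X : family) :
  is_family n (D := D) X -> is_family n (D := D') (transfer X).
Proof.
move=> famX v; rewrite /cycle_at transferE; case: ifP => _; first exact: diff0.
by rewrite diff_pscale famX; apply/ffunP => t; rewrite !ffunE mulr0.
Qed.

Lemma msize_sign_above v : msize (sign_above P v c * q) = msize q.
Proof. by rewrite /sign_above -signr_odd mulr_sign; case: ifP => // _; apply: mmeasureN. Qed.

Lemma deg_le_pscale (v : vertex) (k : nat) (j : int) (r : poly_ring) (f : chain) :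
  (msize r <= k.+1)%N -> deg_le n v j f -> deg_le n v (j + 2 * k%:Z) (pscale r f).
Proof.
move=> rk fj t; rewrite ffunE mulf_eq0 negb_or => /andP[r0 ft0].
have := fj t ft0; rewrite msizeM //; move: (state_shift _ _ _) => s.
have : (0 < msize r)%N by rewrite lt0n mmeasure_poly_eq0.
have : (0 < msize (f t))%N by rewrite lt0n mmeasure_poly_eq0.
move: (msize r) (msize (f t)) rk => r' m; lia.
Qed.

Lemma transfer_HKh (G : family) (k : nat) (j d : int) :
  (msize q <= k.+1)%N ->
  (forall v : vertex, v c = false ->
     qshift n (D := D') v - qshift n (D := D) v + 2 * k%:Z = d) ->
  (forall v, boundary n v (transfer G v - G v)) ->
  HKh_filt n (D := D) j G -> HKh_filt n (D := D') (j + d) G.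
Proof.
move=> qk shift GG [Y [[famY cycY] [Z [famZ hom]] filt]].
exists (transfer Y); split.
- split; first exact: transfer_family.
  move=> v; have cyc : boundary n v (cube_diff n (D := D) Y v - (0 : family) v) := cycY v.
  change (boundary n v (cube_diff n (D := D') (transfer Y) v - (0 : family) v)).
  have z0 : (0 : family) v = 0 by rewrite ffunE.
  rewrite z0 !subr0 in cyc *.
  have := boundaryD (transfer_boundary cyc) (boundaryN (transfer_chain famY v)).
  by rewrite opprB addrC subrK.
- exists (transfer Z); split; first exact: transfer_family.
  move=> v; pose dZ : family := cube_diff n (D := D) Z.
  pose dZ' : family := cube_diff n (D := D') (transfer Z).
  have homE : boundary n v ((G - Y) v - dZ v) := hom v.
  change (boundary n v ((G - transfer Y) v - dZ' v)).
  have H1 := boundaryN (GG v).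
  have H2 : boundary n v (transfer (G - Y - dZ) v).
    by apply: transfer_boundary; move: homE; rewrite !ffunE.
  have H3 : boundary n v (transfer dZ v - dZ' v) := transfer_chain famZ v.
  have := boundaryD H1 (boundaryD H2 H3); rewrite !transferB.
  have subE (X1 X2 : family) : (X1 - X2) v = X1 v - X2 v by rewrite !ffunE.
  have cancel (V : zmodType) (a g y z e : V) :
    - (a - g) + ((a - y - z) + (z - e)) = g - y - e.
    by rewrite opprB [a - y - z + _]addrA subrK !addrA subrK.
  by rewrite !subE cancel.
- move=> v; have [y [cyc hom' dy]] := filt v.
  have [vc|vc] := boolP (v c).
    exists 0; rewrite /cycle_at diff0; split=> //; last by move=> t; rewrite ffunE eqxx.
    by rewrite /homologous transferE vc subrr; exists 0; rewrite diff0.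
  exists (pscale (sign_above P v c * q) y); split.
  + rewrite /cycle_at diff_pscale cyc -[0](pscale0 0) pscaleA mulr0.
    by rewrite !pscale0.
  + rewrite /homologous transferE (negPf vc).
    have [z E] := hom'; exists (pscale (sign_above P v c * q) z).
    rewrite diff_pscale -E.
    by apply/ffunP => t; rewrite !ffunE mulrBr.
  + have -> : j + d - qshift n (D := D') v = j - qshift n (D := D) v + 2 * k%:Z.
      by rewrite -(shift v) ?(negPf vc) //; ring.
    by apply: deg_le_pscale => //; rewrite msize_sign_above.
Qed.

End Transfer.

(** * The crossing change *)

(** The height of v and half of the drop of the writhe cancel in the homological
    degree, so that only the term (1 - n) w of the shift changes. *)
Lemma qshift_crossing_change n (S : shadow) (wf : well_formed S)
    (P P' : 'I_(ncr S) -> bool) (c : 'I_(ncr S)) (v : vertex S) :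
  P c -> P' c = false -> (forall d, d != c -> P' d = P d) -> v c = false ->
  qshift n (D := @Diagram S P' wf) v = qshift n (D := @Diagram S P wf) v + 2 * (n%:Z - 1).
Proof.
move=> Pc P'c Pd vc; rewrite /qshift /hdeg /writhe /height_bit /=.
pose w : int := \sum_(d | d != c) (if P d then 1 else -1).
pose h := (\sum_(d | d != c) (v d == P d))%N.
have -> : \sum_(d < ncr S) (if P' d then 1 else -1) = -1 + w :> int.
  by rewrite (bigD1 c) //= P'c; congr (_ + _); apply: eq_bigr => d /Pd ->.
have -> : \sum_(d < ncr S) (if P d then 1 else -1) = 1 + w :> int.
  by rewrite (bigD1 c) //= Pc.
have -> : (\sum_(d < ncr S) (v d == P' d) = h.+1)%N.
  by rewrite (bigD1 c) //= vc P'c; congr _.+1; apply: eq_bigr => d /Pd ->.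
have -> : (\sum_(d < ncr S) (v d == P d) = h)%N.
  by rewrite (bigD1 c) //= vc Pc.
have -> : (((ncr S)%:Z - (-1 + w)) %/ 2)%Z = (((ncr S)%:Z - (1 + w)) %/ 2)%Z + 1.
  by lia.
by rewrite -addn1 PoszD; ring.
Qed.

Section Eigenfamily.
Variables (R : realType) (n : nat) (S : shadow) (wf : well_formed S).
Variables (P : 'I_(ncr S) -> bool) (c : 'I_(ncr S)).
Local Notation poly_ring := {mpoly R[i][nmark S]}.
Let D := @Diagram S P wf.

(** The factor [sign_above] cancels the sign of [transfer] at the oriented
    resolution. *)
Lemma transfer_g_family i (r : poly_ring) : acts_on_g n i r 1 -> forall v : vertex S,
  boundary n v (transfer P c (sign_above R P (vertex0 S) c * r) (g_family R n D i) v
           - g_family R n D i v).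
Proof.
move=> r1 v; rewrite transferE.
have -> : g_family R n D i v = if v == vertex0 S then g_cycle R n S i else 0.
  by rewrite ffunE.
case: eqP => [->|_]; last first.
  by rewrite pscaler0 if_same subr0; apply: boundary0.
rewrite ffunE mulrA -expr2 sqrr_sign mul1r.
have := r1; rewrite /acts_on_g mpolyC1 pscaleDl.
suff -> : pscale (-1) (g_cycle R n S i) = - g_cycle R n S i by [].
by apply/ffunP => t; rewrite !ffunE mulN1r.
Qed.

End Eigenfamily.

Lemma s_n_crossing_change (R : realType) (n : nat) (S : shadow)
    (wf : well_formed S) (P P' : 'I_(ncr S) -> bool) (c : 'I_(ncr S)) (i : nat) :
  (0 < n)%N -> P c -> P' c = false -> (forall d, d != c -> P' d = P d) ->
  `|s_n R n (@Diagram S P wf) i - s_n R n (@Diagram S P' wf) i| <= 2 * (n%:Z - 1).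
Proof.
move=> n0 Pc P'c P'd; rewrite /s_n.
pose D := @Diagram S P wf; pose D' := @Diagram S P' wf.
pose A j := HKh_filt n (D := D') j (g_family R n D' i).
pose B j := HKh_filt n (D := D) j (g_family R n D i).
have -> : qgr n (D := D) (g_family R n D i) - n%:Z + 1
  - (qgr n (D := D') (g_family R n D' i) - n%:Z + 1) = least B - least A.
  by rewrite /qgr -/(least _) /A /B; ring.
pose s Q := sign_above R Q (vertex0 S) c.
have qs (v : vertex S) : v c = false ->
    qshift n (D := D') v = qshift n (D := D) v + 2 * (n%:Z - 1).
  exact: qshift_crossing_change.
have sizes Q (r : {mpoly R[i][nmark S]}) : msize (s Q * r) = msize r.
  by rewrite /s msize_sign_above.
apply: least_close.
- by lia.
- move=> j Aj.
  (* Dividing by the eigenvalue of the polynomial on g_i makes the map fix g_i. *)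
  pose kappa := n%:R * xi R n ^+ i ^+ n.-1.
  pose h := complete_hom n ('X_(inc c true) : {mpoly R[i][nmark S]}) 'X_(inc c false).
  have r1 : acts_on_g n i (kappa^-1%:MP * h) 1.
    rewrite -(mulVf (complete_hom_eigenvalue_neq0 R i n0)).
    by apply: actsM; [apply: actsC | apply: acts_complete_hom].
  rewrite -[j]addr0.
  apply: (@transfer_HKh R n S wf P' P c _ _ (s P' * (kappa^-1%:MP * h)) _ _ n.-1 j 0 _ _ _ Aj).
  + by rewrite P'c Pc.
  + by move=> d /P'd ->.
  + move=> _ v f vc cyc; rewrite mulrA -pscaleA.
    by apply: boundary_pscale; apply: complete_hom_boundary.
  + rewrite sizes prednK // mul_mpolyC; apply: leq_trans (msizeZ_le _ _) _.
    exact: msize_complete_hom.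
  + move=> v /qs ->; have -> : n.-1%:Z = n%:Z - 1 by lia.
    by ring.
  + exact: transfer_g_family.
- move=> j Bj.
  have r1 : acts_on_g n i (1 : {mpoly R[i][nmark S]}) 1 by rewrite -{1}mpolyC1; apply: actsC.
  apply: (@transfer_HKh R n S wf P P' c _ _ (s P * 1) _ _ 0 j _ _ _ _ Bj).
  + by rewrite P'c Pc.
  + exact: P'd.
  + by move=> /negbT/negP [].
  + by rewrite sizes msize1.
  + by move=> v /qs ->; ring.
  + exact: transfer_g_family.
Qed.

Theorem theorem5 (R : realType) (n : nat) (hn : (2 <= n)%N)
    (D : diagram) (c : 'I_(ncr D)) (hc : positive c) (i : 'I_n) :
  `|s_n R n D i - s_n R n (crossing_change c) i| <= 2 * (n%:Z - 1).
Proof.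
case: D c hc => S P wf c hc; rewrite /= in c hc *.
apply: (@s_n_crossing_change R n S wf P
  (fun d => if d == c then ~~ P d else P d) c i (ltnW hn) hc).
  by rewrite eqxx hc.
by move=> d dc; rewrite /= ifN.
Qed.
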